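(* In the $2$-Labeled Coupon Collector Problem on $n\ge 3$ coupons, let $T(1)$ be the number of samples needed until at least one coupon has its label determined, and let $m=\frac{(n-2)(n+1)}{2}$. Then $$\mathbb{E}[T(1)] = 1+\sum_{i=1}^{\lfloor n/2\rfloor}\frac{n!}{(n-2i)!\,2^i}\cdot\frac{(m-i)!}{m!},$$ and $\mathbb{E}[T(1)]=O(n)$ as $n\to\infty$.
   Context: $2$-Labeled Coupon Collector Problem: there are $n$ coupons $C$ and $n$ labels $L$ with an unknown bijection $\sigma:C\to L$. Samples are independent; each sample is a uniformly random $2$-element subset $S\subseteq C$, and the collector observes only the pair of sets $(S,\sigma(S))$, not which label goes with which coupon. The collector has no prior knowledge of $C$ and $L$ beyond what appears in samples. After samples $(S_1,\sigma(S_1)),\dots,(S_t,\sigma(S_t))$, let $C_t=\bigcup_i S_i$, $L_t=\bigcup_i\sigma(S_i)$; a bijection $f:C_t\to L_t$ is consistent if $f(S_i)=\sigma(S_i)$ for all $i$, and a coupon $c$ has its label determined if $c\in C_t$ and all consistent $f$ agree at $c$. $T(1)$ is the least $t$ such that at least one coupon has its label determined. *)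

(* Defs.v *)
From HB Require Import structures.
From mathcomp Require Import all_boot all_order all_algebra finmap.
From mathcomp Require Import all_classical all_reals all_analysis.

Set Implicit Arguments.
Unset Strict Implicit.
Unset Printing Implicit Defensive.

Import Order.TTheory GRing.Theory Num.Theory.
Import numFieldNormedType.Exports.

Local Open Scope classical_set_scope.
Local Open Scope ring_scope.

Section Observations.
Variables C L : finType.

Definition observation : Type := ({set C} * {set L})%type.

Definition observe (sigma : C -> L) (S : {set C}) : observation :=
  (S, sigma @: S).

Definition seen_coupons (obs : seq observation) : {set C} :=
  (\bigcup_(o <- obs) o.1)%SET.

Definition seen_labels (obs : seq observation) : {set L} :=
  (\bigcup_(o <- obs) o.2)%SET.

(* A bijection from the coupons seen to the labels seen is represented by a
   total function, whose values outside [seen_coupons obs] are irrelevant. *)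
Definition consistent (obs : seq observation) (f : C -> L) : Prop :=
  [/\ set_bij [set` seen_coupons obs] [set` seen_labels obs] f
    & forall o, o \in obs -> f @: o.1 = o.2].

Definition label_determined (obs : seq observation) (c : C) : Prop :=
  c \in seen_coupons obs /\
  forall f g : C -> L, consistent obs f -> consistent obs g -> f c = g c.

End Observations.

Section DiscreteRandomElements.
Context {d : measure_display} {Omega : measurableType d} {R : realType}.
Variables (P : probability Omega R) (T : finType).

(* [T] carries the discrete sigma-algebra. *)
Definition random_element (X : Omega -> T) : Prop :=
  forall A : set T, measurable (X @^-1` A).

Definition uniform_on (D : {set T}) (X : Omega -> T) : Prop :=
  forall x : T, P (X @^-1` [set x]) = ((x \in D)%:R / #|D|%:R)%:E.

Definition mutually_independent (X : nat -> Omega -> T) : Prop :=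
  forall (I : {fset nat}) (A : nat -> set T),
    P (\bigcap_(i in [set` I]) X i @^-1` A i) =
    (\prod_(i <- I) P (X i @^-1` A i))%E.

End DiscreteRandomElements.

Record coupon_problem (R : realType) (n : nat) := CouponProblem {
  coupon : finType;
  label : finType;
  card_coupon : #|coupon| = n;
  labeling : coupon -> label;
  labeling_bij : bijective labeling;
  display : measure_display;
  space : measurableType display;
  prob : probability space R;
  (* [sample i] is the sample number i + 1. *)
  sample : nat -> space -> {set coupon};
  sample_random : forall i, random_element (sample i);
  sample_uniform :
    forall i, uniform_on prob [set S : {set coupon} | #|S| == 2]%SET (sample i);
  sample_independent : mutually_independent prob sample
}.

Section FirstDeterminedLabel.
Variables (R : realType) (n : nat) (X : coupon_problem R n).

Definition observations (t : nat) (w : space X) :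
    seq (observation (coupon X) (label X)) :=
  [seq observe (labeling (c := X)) (sample i w) | i <- iota 0 t].

(* T(1), which is +oo when no label is ever determined. *)
Definition T1 (w : space X) : \bar R :=
  ereal_inf [set t%:R%:E | t in
    [set t : nat | exists c, label_determined (observations t w) c]].

(* The library's ['E_P[_]] is the same integral, but restricted to
   real-valued random variables. *)
Definition expected_T1 : \bar R := (\int[prob X]_w T1 w)%E.

End FirstDeterminedLabel.

(* Main.v *)
(* A vertex covered by two distinct intersecting pairs has its label determined,
   while the two ends of an isolated pair can be swapped. So no label is
   determined exactly when the pairs drawn so far form a matching of the complete
   graph on the coupons, and E[T(1)] is the expected time during which they do.
   A matching with k edges stays unchanged with probability k / C(n,2) and gains
   an edge, still being a matching, with probability C(n - 2k, 2) / C(n,2). Hence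
   the expected time f(k) spent at matchings with k edges satisfies
   (C(n,2) - k) f(k) = C(n - 2(k - 1), 2) f(k - 1), with f(0) = 1, which yields
   the formula. As C(n - 2(k - 1), 2) <= C(n,2) - k for k >= 2, the sequence f
   decreases from f(1) <= 2 on, whence E[T(1)] = O(n). *)
Require Import Defs.
From mathcomp Require Import all_boot all_order all_algebra finmap perm.
From mathcomp Require Import all_classical all_reals all_analysis.
From mathcomp Require Import zify ring lra.

Set Implicit Arguments.
Unset Strict Implicit.
Unset Printing Implicit Defensive.

Import Order.TTheory GRing.Theory Num.Theory.
Import numFieldNormedType.Exports.

Local Open Scope classical_set_scope.
Local Open Scope ring_scope.

(** * Determined labels and matchings *)

Section Determination.
Variables (C L : finType) (sigma : C -> L).
Hypothesis sigma_bij : bijective sigma.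

Let obs_of (s : seq {set C}) := [seq observe sigma e | e <- s].

Lemma mem_seen_coupons (s : seq {set C}) (c : C) :
  (c \in seen_coupons (obs_of s)) = has (fun e : {set C} => c \in e) s.
Proof.
rewrite /seen_coupons big_map.
elim: s => [|e s IH]; first by rewrite big_nil inE.
by rewrite big_cons inE IH.
Qed.

Lemma mem_seen_labels (s : seq {set C}) (l : L) :
  (l \in seen_labels (obs_of s)) = has (fun e : {set C} => l \in sigma @: e) s.
Proof.
rewrite /seen_labels big_map.
elim: s => [|e s IH]; first by rewrite big_nil inE.
by rewrite big_cons inE IH.
Qed.

(** Only injectivity survives from the bijection: seen coupons and seen labels are the unions of the
    sets [e] and [sigma @: e], so the equations [f @: e = sigma @: e] already make [f] map the
    former onto the latter. *)
Lemma consistentP (s : seq {set C}) (f : C -> L) :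
  consistent (obs_of s) f <->
  {in seen_coupons (obs_of s) &, injective f} /\
  {in s, forall e : {set C}, f @: e = sigma @: e}.
Proof.
split.
  case=> -[_ f_inj _] f_obs; split.
    by move=> x y sx sy; apply: f_inj; rewrite inE.
  move=> e sS; exact: (f_obs (observe sigma e) (map_f _ sS)).
case=> f_inj f_obs; split; last first.
  by move=> o /mapP[e sS ->]; exact: f_obs.
split.
- move=> c /=; rewrite mem_seen_coupons mem_seen_labels => /hasP[e sS cS].
  by apply/hasP; exists e => //; rewrite -f_obs// imset_f.
- by move=> x y; rewrite !inE /=; exact: f_inj.
- move=> l /=; rewrite mem_seen_labels => /hasP[e sS].
  rewrite -f_obs// => /imsetP[c cS ->]; exists c => //=.
  by rewrite mem_seen_coupons; apply/hasP; exists e.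
Qed.

Lemma label_determined_sub (s s' : seq {set C}) (c : C) :
  {subset s <= s'} ->
  label_determined (obs_of s) c -> label_determined (obs_of s') c.
Proof.
move=> ss' [cs det]; have sub x :
    x \in seen_coupons (obs_of s) -> x \in seen_coupons (obs_of s').
  by rewrite !mem_seen_coupons => /hasP[e /ss' sS xS]; apply/hasP; exists e.
have cons f : consistent (obs_of s') f -> consistent (obs_of s) f.
  move=> /consistentP[f_inj f_obs]; apply/consistentP; split.
    by move=> x y xs ys; apply: f_inj; exact: sub.
  by move=> e /ss'; exact: f_obs.
by split=> [|f g cf cg]; [exact: sub | apply: det; exact: cons].
Qed.

(** Draws may repeat, so equal entries are allowed and count as one edge. *)
Definition matching (s : seq {set C}) : bool :=
  all (fun e : {set C} => all (fun e' => (e == e') || [disjoint e & e']) s) s.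

Lemma matchingP (s : seq {set C}) :
  reflect {in s &, forall e e' : {set C}, e <> e' -> [disjoint e & e']%B}
    (matching s).
Proof.
apply: (iffP idP).
  by move=> /allP h e e' /h/allP/[apply] /orP[/eqP|].
move=> h; apply/allP => e sS; apply/allP => e' sS'.
by have [//|/eqP ee'] := eqVneq e e'; exact: h.
Qed.

Lemma exists_label_determined (s : seq {set C}) :
  all (fun e : {set C} => #|e| == 2%N) s ->
  (exists c, label_determined (obs_of s) c) <-> ~~ matching s.
Proof.
have sigma_inj : injective sigma by exact: bij_inj.
move=> /allP s2; split.
- case=> c [cs det]; apply/negP => /matchingP sm.
  move: (cs); rewrite mem_seen_coupons => /hasP[e sS cS].
  have /cards2P[a [b [ab Sab]]] := s2 _ sS.
  have sigma_cons : consistent (obs_of s) sigma.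
    by apply/consistentP; split=> [x y _ _ /sigma_inj|].
  (* Swapping the two ends of an isolated edge preserves every observation. *)
  have swap_cons : consistent (obs_of s) (sigma \o tperm a b).
    apply/consistentP; split=> [x y _ _ /sigma_inj/perm_inj//|e' sS'].
    rewrite imset_comp; suff -> : tperm a b @: e' = e' by [].
    (* The swap exchanges the ends of [e] and fixes every other edge pointwise, as these are
       disjoint from [e]. *)
    have [<-|/eqP e'e] := eqVneq e e'.
      by rewrite Sab imsetU1 imset_set1 tpermL tpermR finset.setUC.
    have /disjointFr dis := sm _ _ sS sS' e'e.
    rewrite -[RHS]imset_id; apply: eq_in_imset => x xS'.
    apply: tpermD; apply/eqP => xE; move: xS';
      by rewrite -xE dis// Sab !inE eqxx ?orbT.
  have := det _ _ sigma_cons swap_cons => /sigma_inj /=.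
  move: cS; rewrite Sab !inE => /orP[] /eqP ->.
    by rewrite tpermL => /eqP; rewrite (negPf ab).
  by rewrite tpermR => /esym/eqP; rewrite (negPf ab).
- move=> /matchingP => nm.
  have [e [e' [sS sS' ee' ndis]]] : exists e e',
      [/\ e \in s, e' \in s, e <> e' & ~~ [disjoint e & e']].
    apply: contrapT => h; apply: nm => e e' sS sS' ee'.
    by apply/negPn/negP => ndis; apply: h; exists e, e'.
  (* Two distinct sets of size 2 that meet share exactly one point. *)
  have [c cE] : exists c, e :&: e' = [set c]%SET.
    apply/cards1P; rewrite eqn_leq.
    rewrite card_gt0 setI_eq0 ndis andbT leqNgt; apply/negP => c2.
    apply: ee'; have e2 := eqP (s2 _ sS); have e'2 := eqP (s2 _ sS').
    have -> : e = e :&: e' by apply/eqP; rewrite eq_sym eqEcard subsetIl e2.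
    by apply/eqP; rewrite eqEcard subsetIr e'2.
  have cS : c \in e by have := set11 c; rewrite -cE => /setIP[].
  have cS' : c \in e' by have := set11 c; rewrite -cE => /setIP[].
  (* The value [f c] lies in both [sigma @: e] and [sigma @: e'], which meet only in [sigma c]
     because [sigma] is injective. *)
  have detc f : consistent (obs_of s) f -> f c = sigma c.
    move=> /consistentP[_ f_obs]; apply/set1P.
    rewrite -imset_set1 -cE imsetI; last by move=> x y _ _ /sigma_inj.
    by rewrite -!f_obs// inE !imset_f.
  exists c; split=> [|f g /detc -> /detc -> //].
  by rewrite mem_seen_coupons; apply/hasP; exists e.
Qed.

End Determination.

(** * Counting sequences of draws that form a matching *)

Section CountingMatchings.
Variable V : finType.

Definition pairs (s : seq {set V}) : bool :=
  all (fun e : {set V} => #|e| == 2%N) s.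

Lemma matching_cons (e : {set V}) (s : seq {set V}) :
  matching (e :: s) =
  matching s && all (fun e' : {set V} => (e == e') || [disjoint e & e']) s.
Proof.
rewrite /matching /= eqxx /= (all_predI (fun e' => (e' == e) || _)) andbA.
rewrite [RHS]andbC; congr (_ && _).
rewrite -[RHS]andbb; congr (_ && _).
by apply: eq_all => e' /=; rewrite eq_sym disjoint_sym.
Qed.

Let vertices (s : seq {set V}) : {set V} := (\bigcup_(e <- s) e)%SET.

Lemma disjoint_vertices (e : {set V}) (s : seq {set V}) :
  [disjoint e & vertices s]%B = all (fun e' : {set V} => [disjoint e & e']%B) s.
Proof.
rewrite -setI_eq0 /vertices; elim: s => [|e' s IH].
  by rewrite big_nil finset.setI0 eqxx.
by rewrite big_cons finset.setIUr finset.setU_eq0 IH setI_eq0.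
Qed.

Lemma matching_cons_pairs (e : {set V}) (s : seq {set V}) :
  pairs s -> matching s -> #|e| = 2%N ->
  matching (e :: s) = (e \in s) || [disjoint e & vertices s].
Proof.
move=> ps ms e2; rewrite matching_cons ms /=.
have [es|es] := boolP (e \in s) => /=.
  apply/allP => e' e's; have [//|/eqP ee'] := eqVneq e e'.
  by rewrite (matchingP _ ms).
rewrite disjoint_vertices; apply: eq_in_all => e' e's.
by case: eqVneq => //= ee'; move: es; rewrite ee' e's.
Qed.

Lemma card_vertices (s : seq {set V}) :
  pairs s -> matching s -> #|vertices s| = (2 * size (undup s))%N.
Proof.
elim: s => [_ _|e s IH]; first by rewrite /vertices big_nil cards0.
move=> /andP[/eqP e2 ps] mes.
have ms : matching s by move: mes; rewrite matching_cons => /andP[].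
rewrite [vertices _]big_cons -/(vertices s) /=.
case: ifPn => [es|es].
  rewrite (finset.setUidPr _) ?IH//; apply/fintype.subsetP => x xe.
  by rewrite /vertices finset.bigcup_seq; apply/finset.bigcupP; exists e.
move: mes; rewrite matching_cons_pairs// (negPf es)/= => dis.
by rewrite cardsU finset.disjoint_setI0// cards0 subn0 IH// e2 mulnS.
Qed.

(** Isolates one draw for the recurrence in [t]. The new draw is put at the head, which is harmless
    because the counts do not depend on the order. *)
Lemma sum_tuple_cons (T : finType) (t : nat) (F : seq T -> nat) :
  (\sum_(s : t.+1.-tuple T) F s = \sum_(s : t.-tuple T) \sum_x F (x :: s))%N.
Proof.
rewrite exchange_big pair_big /=.
rewrite (reindex (fun p : T * t.-tuple T => cons_tuple p.1 p.2))//.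
exists (fun s => (thead s, behead_tuple s)) => [[x s] _|s _].
  by congr pair; exact: val_inj.
by rewrite [RHS]tuple_eta; exact: val_inj.
Qed.

Definition matching_draws (t k : nat) : nat :=
  \sum_(s : t.-tuple {set V})
     [&& pairs s, matching s & size (undup s) == k].

Lemma matching_draws0 (k : nat) : matching_draws 0 k = (k == 0%N).
Proof.
rewrite /matching_draws (eq_bigr (fun=> (k == 0%N) : nat)).
  by rewrite sum_nat_const card_tuple expn0 mul1n.
by move=> s _; rewrite tuple0 /= eq_sym.
Qed.

Lemma sum_matching_cons (s : seq {set V}) (k : nat) :
  pairs s -> matching s ->
  (\sum_(e : {set V})
     [&& pairs (e :: s), matching (e :: s) & size (undup (e :: s)) == k] =
   (size (undup s) == k) * k +
   ((size (undup s)).+1 == k) * 'C(#|V| - 2 * size (undup s), 2))%N.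
Proof.
move=> ps ms; set j := size (undup s).
(* The draws that keep a matching are the [j] repeated edges and the pairs of uncovered vertices;
   the two kinds exclude each other since an edge is nonempty. *)
transitivity (\sum_(e : {set V})
    ((j == k) * (e \in s) +
     (j.+1 == k) * ((e \subset ~: vertices s) && (#|e| == 2))))%N.
  apply: eq_bigr => e _; rewrite [pairs _]/= ps andbT.
  have [es|es] := boolP (e \in s).
    have e2 := allP ps _ es; rewrite e2 matching_cons_pairs ?(eqP e2)// es /=.
    rewrite es -/j -finset.disjoints_subset muln1.
    suff /negPf -> : ~~ [disjoint e & vertices s] by rewrite /= muln0 addn0.
    rewrite disjoint_vertices; apply/allPn; exists e => //.
    by rewrite -setI_eq0 finset.setIid -card_gt0 (eqP e2).
  rewrite muln0 add0n -finset.disjoints_subset /= (negPf es) -/j.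
  have [e2|] := boolP (#|e| == 2); last by rewrite andbF muln0.
  rewrite matching_cons_pairs ?(eqP e2)// (negPf es) andbT /=.
  by case: [disjoint e & vertices s]%B; case: (_ == k).
rewrite big_split /= -!big_distrr /=; congr (_ + _)%N.
  rewrite -big_mkcond sum1_card /=.
  rewrite -(eq_card (mem_undup s)) (card_uniqP (undup_uniq s)) -/j.
  by have [->|] := eqVneq j k.
have -> : (#|V| - 2 * j = #|~: vertices s|)%N.
  by rewrite cardsCs finset.setCK card_vertices.
rewrite -cards_draws -big_mkcond -sum1_card.
by under [in RHS]eq_bigl do rewrite inE.
Qed.

(** The last draw either repeats one of [k] edges or adds an edge to [k.-1] others. The factor
    [0 < k] removes the second case at [k = 0], where [k.-1] is again 0. *)
Lemma matching_drawsS (t k : nat) :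
  matching_draws t.+1 k =
  (k * matching_draws t k +
   (0 < k) * 'C(#|V| - 2 * k.-1, 2) * matching_draws t k.-1)%N.
Proof.
rewrite /matching_draws
  (sum_tuple_cons _
     (fun s => [&& pairs s, matching s & size (undup s) == k] : nat)).
rewrite !big_distrr -big_split; apply: eq_bigr => s _.
have [/andP[ps ms]|] := boolP (pairs s && matching s); last first.
  move=> /nandP pms; rewrite big1 => [|e _].
    by case: pms => /negPf ->; rewrite ?andbF /= !muln0.
  by rewrite matching_cons /=; case: pms => /negPf ->; rewrite ?andbF.
rewrite sum_matching_cons// ps ms /= mulnC; congr (_ + _)%N.
case: k => [|k]; first by rewrite /= !mul0n.
rewrite eqSS mul1n; have [->|] := eqVneq; rewrite ?muln0 ?muln1 ?mul1n//.
Qed.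

Lemma leq_size_matching (s : seq {set V}) :
  pairs s -> matching s -> (2 * size (undup s) <= #|V|)%N.
Proof. by move=> ps ms; rewrite -card_vertices// max_card. Qed.

End CountingMatchings.

(** * Expected time spent at matchings of each size *)

Section ExpectedTimes.
Variable R : realType.

(** The fixed point of [x = r * x + l] bounds the nondecreasing sequence [u], which therefore
    converges; passing to the limit in the recurrence identifies its limit. *)
Lemma cvg_affine_recurrence (u v : R^nat) (r l : R) :
  0 <= r < 1 -> nondecreasing_seq u -> u 0%N <= l / (1 - r) ->
  (forall t, u t.+1 = r * u t + v t) ->
  (forall t, v t <= l) -> v @ \oo --> l ->
  u @ \oo --> l / (1 - r).
Proof.
move=> /andP[r0 r1] u_nd u0 urec vl v_cvg.
have r1_gt0 : 0 < 1 - r by rewrite subr_gt0.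
have u_le t : u t <= l / (1 - r).
  elim: t => // t IH; rewrite urec.
  have -> : l / (1 - r) = r * (l / (1 - r)) + l by field; rewrite gt_eqF.
  by apply: lerD; [exact: ler_wpM2l | exact: vl].
have u_cvg : cvgn u.
  by apply: nondecreasing_is_cvgn => //; exists (l / (1 - r)) => _ [t _ <-].
suff <- : limn u = l / (1 - r) by [].
have ulim : limn u = r * limn u + l.
  apply: (@cvg_unique R _ (u t.+1 @[t --> \oo])) => //.
    by rewrite /= (cvg_shiftS u).
  rewrite /=; under eq_cvg do rewrite urec.
  by apply: cvgD => //; apply: cvgMl_tmp.
apply: (canRL (mulfK _)); first by rewrite gt_eqF.
lra.
Qed.

(* Expected time during which the pairs drawn form a matching with [k] edges;
   in the paper's notation, ['C(n, 2).-1] is m. *)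
Definition matching_time (n k : nat) : R :=
  n`!%:R / ((n - 2 * k)`!%:R * 2 ^+ k) *
  (('C(n, 2).-1 - k)`!%:R / ('C(n, 2).-1)`!%:R).

(** Makes the divisor ['C(n, 2) - k] positive and keeps the natural subtraction ['C(n, 2).-1 - k]
    from being truncated. *)
Lemma ltn_bin2 (n k : nat) : (3 <= n)%N -> (2 * k <= n)%N -> (k < 'C(n, 2))%N.
Proof. by move=> n3 kn; rewrite bin2; case: n n3 kn => // n; nia. Qed.

Lemma matching_time0 (n : nat) : matching_time n 0 = 1.
Proof.
rewrite /matching_time muln0 !subn0 expr0 mulr1 !divff ?mulr1//.
all: by rewrite pnatr_eq0 -lt0n fact_gt0.
Qed.

Lemma matching_timeS (n k : nat) : (3 <= n)%N -> (2 * k.+1 <= n)%N ->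
  ('C(n, 2)%:R - k.+1%:R) * matching_time n k.+1 =
  'C(n - 2 * k, 2)%:R * matching_time n k.
Proof.
move=> n3 kn; have := ltn_bin2 n3 kn; rewrite /matching_time.
set N := 'C(n, 2) => kN.
(* Written as successors, the arguments let the factorials unfold until both sides agree as rational
   expressions. *)
have -> : (n - 2 * k = (n - 2 * k.+1).+2)%N by lia.
have -> : (N.-1 - k = (N.-1 - k.+1).+1)%N by lia.
set a := (n - 2 * k.+1)%N.
have -> : N%:R - k.+1%:R = (N.-1 - k.+1).+1%:R :> R.
  by rewrite -natrB ?(ltnW kN)//; congr (_%:R); lia.
set b := (N.-1 - k.+1)%N.
have -> : 'C(a.+2, 2)%:R = a.+2%:R * a.+1%:R / 2 :> R.
  apply/(mulIf (_ : 2 != 0 :> R)) => //; rewrite divfK//.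
  by rewrite -!natrM; congr (_%:R);
    have := bin_ffact a.+2 2; rewrite !ffactnS ffactn0 muln1.
have f0 j : j`!%:R != 0 :> R by rewrite pnatr_eq0 -lt0n fact_gt0.
rewrite !factS !natrM exprS; field.
by rewrite !f0 expf_neq0//= !gt_eqF ?ltr_pwDl.
Qed.

Lemma matching_time_ge0 (n k : nat) : 0 <= matching_time n k.
Proof. by rewrite mulr_ge0// divr_ge0// mulr_ge0// exprn_ge0. Qed.

Lemma matching_time_le2 (n k : nat) :
  (3 <= n)%N -> (2 * k <= n)%N -> matching_time n k <= 2.
Proof.
move=> n3; elim: k => [_|k IH kn]; first by rewrite matching_time0 ler1n.
have N_gt0 : 0 < 'C(n, 2)%:R - k.+1%:R :> R by rewrite subr_gt0 ltr_nat ltn_bin2.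
rewrite -(ler_pM2l N_gt0) matching_timeS//.
have N3 : (3 <= 'C(n, 2))%N by rewrite (leq_trans _ (leq_bin2l 2 n3)).
(* The first ratio, N / (N - 1) with N = ['C(n, 2)], exceeds 1, so this case needs the exact value 1
   at size 0. All later ratios are at most 1 and preserve the bound 2. *)
case: k => [|k] in IH kn N_gt0 *.
  rewrite matching_time0 muln0 subn0 mulr1.
  have : 3 <= 'C(n, 2)%:R :> R by rewrite ler_nat.
  lra.
have /le_trans -> // : 'C(n - 2 * k.+1, 2)%:R * matching_time n k.+1 <=
    'C(n - 2 * k.+1, 2)%:R * 2.
  by apply: ler_wpM2l => //; apply: IH; lia.
apply: ler_wpM2r => //; rewrite lerBrDr -natrD ler_nat.
by rewrite !bin2; nia.
Qed.

Variable V : finType.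
Hypothesis V3 : (3 <= #|V|)%N.

Definition matching_prob (t k : nat) : R :=
  (matching_draws V t k)%:R / 'C(#|V|, 2)%:R ^+ t.

Lemma matching_probS (t k : nat) :
  matching_prob t.+1 k =
  k%:R / 'C(#|V|, 2)%:R * matching_prob t k +
  (0 < k)%N%:R * ('C(#|V| - 2 * k.-1, 2)%:R / 'C(#|V|, 2)%:R)
    * matching_prob t k.-1.
Proof.
have N0 : 'C(#|V|, 2)%:R != 0 :> R.
  by rewrite pnatr_eq0 -lt0n bin_gt0 ltnW.
rewrite /matching_prob matching_drawsS natrD !natrM exprS; field.
by rewrite N0 expf_neq0.
Qed.

(** Summing [matching_probS] over time gives an affine recurrence for the partial sums, with ratio k
    / N for N = ['C(#|V|, 2)] and an added term built from the partial sums for [k.-1], whose limit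
    is known by induction. *)
Lemma cvg_matching_time (k : nat) : (2 * k <= #|V|)%N ->
  series (matching_prob ^~ k) @ \oo --> matching_time #|V| k.
Proof.
have prob_ge0 t j : 0 <= matching_prob t j by rewrite divr_ge0// exprn_ge0.
have series_nd j : nondecreasing_seq (series (matching_prob ^~ j)).
  by apply: nondecreasing_series => t _ _; exact: prob_ge0.
have seriesS j t : series (matching_prob ^~ j) t.+1 =
    matching_prob 0 j + \sum_(0 <= i < t) matching_prob i.+1 j.
  by rewrite /series /= big_nat_recl.
elim: k => [_|k IH kn].
  (* Size 0 occurs only before the first draw: the ratio is 0 and the added term is 1. *)
  rewrite matching_time0; have -> : 1 = 1 / (1 - 0) :> R by rewrite subr0 divr1.
  apply: (@cvg_affine_recurrence _ (fun=> 1)) => //.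
  - by rewrite lexx ltr01.
  - by rewrite /series /= big_geq// divr_ge0// subr0.
  - move=> t; rewrite seriesS big1 => [|i _].
      by rewrite /matching_prob matching_draws0 expr0 divr1 mul0r addr0 add0r.
    by rewrite matching_probS !mul0r addr0.
  - exact: cvg_cst.
set N := 'C(#|V|, 2); set c := 'C(#|V| - 2 * k, 2).
have kN : (k.+1 < N)%N by exact: ltn_bin2.
have N0 : 0 < N%:R :> R by rewrite ltr0n; apply: leq_ltn_trans kN.
have {}IH := IH (ltac:(lia)).
have -> : matching_time #|V| k.+1 =
    c%:R / N%:R * matching_time #|V| k / (1 - k.+1%:R / N%:R).
  have kN0 : N%:R - k.+1%:R != 0 :> R by rewrite subr_eq0 eqr_nat gtn_eqF.
  apply: (mulfI kN0); rewrite matching_timeS//.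
  by field; rewrite nat1r kN0 gt_eqF.
have cN : 0 <= c%:R / N%:R :> R by rewrite divr_ge0.
apply: (@cvg_affine_recurrence _
    (fun t => c%:R / N%:R * series (matching_prob ^~ k) t)) => //.
- by rewrite divr_ge0//= ltr_pdivrMr// mul1r ltr_nat.
- rewrite /series /= big_geq// divr_ge0// ?mulr_ge0// ?matching_time_ge0//.
  by rewrite subr_ge0 ler_pdivrMr// mul1r ler_nat ltnW.
- move=> t; rewrite seriesS /matching_prob matching_draws0 mul0r add0r.
  rewrite (eq_bigr _ (fun i _ => matching_probS i k.+1)) big_split /=.
  by rewrite -!big_distrr /= mul1r.
(* Partial sums of nonnegative terms stay below their limit. *)
- move=> t; apply: ler_wpM2l => //.
  rewrite -(cvg_lim _ IH)//; apply: nondecreasing_cvgn_le => //.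
  by apply/cvg_ex; exists (matching_time #|V| k).
- exact: cvgMl_tmp.
Qed.

End ExpectedTimes.

(** * A hitting time as a sum of indicators *)

Section ExpectedInfimum.
Variable R : realType.
Local Open Scope ereal_scope.

(** The complement of an upward closed set is an initial segment, whose length is the minimum of the
    set; for empty [Q] both sides are +oo. *)
Lemma ereal_inf_upward_closed (Q : set nat) :
  (forall t u, (t <= u)%N -> Q t -> Q u) ->
  ereal_inf [set (t%:R : R)%R%:E | t in Q] =
  \sum_(0 <= t <oo) (\1_(~` Q) t)%:E.
Proof.
move=> Q_up; have ind_ge0 t : 0 <= (\1_(~` Q) t)%:E :> \bar R by rewrite lee_fin.
have sum_lt (m : nat) : (forall t, (t < m)%N -> ~ Q t) ->
    \sum_(0 <= t < m) (\1_(~` Q) t)%:E = m%:R%:E :> \bar R.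
  move=> Qm; rewrite big_nat (eq_bigr (fun=> 1%:E)) => [|t /= tm].
    by rewrite -big_nat sumEFin big_const_nat iter_addr_0 subn0.
  by rewrite indicE mem_set// /setC/=; exact: Qm.
have [[t Qt]|Q0] := pselect (exists t, Q t); last first.
  have noQ t : ~ Q t by move=> Qt; apply: Q0; exists t.
  rewrite (_ : [set _ | _ in Q] = set0) ?ereal_inf0; last first.
    by rewrite -subset0 => x [t Qt _]; exact: (noQ t).
  apply/esym/eqyP => r r0; have [m rm] : exists m : nat, (r <= m%:R)%R.
    by exists (Num.truncn r).+1; rewrite ltW// truncnS_gt.
  apply: le_trans (nneseries_lim_ge m _) => //.
  by rewrite sum_lt ?lee_fin// => t _; exact: noQ.
have exQ : exists t, `[< Q t >] by exists t; apply/asboolP.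
pose m := ex_minn exQ; have [Qm m_min] : Q m /\ forall t, Q t -> (m <= t)%N.
  rewrite /m; case: ex_minnP => u /asboolP Qu u_min; split=> // v Qv.
  by apply: u_min; apply/asboolP.
rewrite (nneseries_split 0 m)// add0n sum_lt => [|u um Qu]; last first.
  by move: (m_min _ Qu); rewrite leqNgt um.
rewrite eseries0 ?adde0 => [|u mu _]; last first.
  by rewrite indicE memNset// => /(_ (Q_up _ _ mu Qm)).
apply/eqP; rewrite eq_le; apply/andP; split.
  by apply: ereal_inf_lbound; exists m.
by apply: le_ereal_inf_tmp => _ [u /m_min mu <-]; rewrite lee_fin ler_nat.
Qed.

End ExpectedInfimum.

(** * The law of the first draws *)

Section FiniteDraws.
Context {d : measure_display} {Omega : measurableType d} {R : realType}.
Variables (P : probability Omega R) (T : finType) (X : nat -> Omega -> T).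
Variable D : {set T}.
Hypotheses (X_random : forall i, random_element (X i))
  (X_uniform : forall i, uniform_on P D (X i))
  (X_independent : mutually_independent P X).

Let draws (t : nat) (w : Omega) : seq T := [seq X i w | i <- iota 0 t].

Let cylinder (t : nat) (s : t.-tuple T) : set Omega :=
  [set w | draws t w = s].

(** For [i < size s] this is the singleton of entry [i]. The tested point serves as the default of
    [nth], since [T] has no distinguished element. *)
Let nth_set (s : seq T) (i : nat) : set T := [set x | nth x s i = x].

(** Brings the event into the form to which [mutually_independent] applies. *)
Lemma cylinderE (t : nat) (s : t.-tuple T) :
  cylinder s = \bigcap_(i in [set` seq_fset tt (iota 0 t)]) X i @^-1` nth_set s i.
Proof.
have memI i : (i \in seq_fset tt (iota 0 t)) = (i < t)%N.
  by rewrite seq_fsetE mem_iota.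
apply/seteqP; split => w.
  move=> dw i; change (i \in seq_fset tt (iota 0 t) -> nth_set s i (X i w)).
  rewrite memI => it.
  by rewrite /nth_set /= -dw (nth_map 0%N) ?size_iota// nth_iota.
move=> nths; apply: (@eq_from_nth _ (X 0%N w)) => [|i].
  by rewrite size_map size_iota size_tuple.
rewrite size_map size_iota => it.
rewrite (nth_map 0%N) ?size_iota// nth_iota// add0n.
have := nths i; rewrite -memI in it => /(_ it) <-.
by apply: set_nth_default; rewrite size_tuple -memI.
Qed.

Lemma measurable_cylinder (t : nat) (s : t.-tuple T) : measurable (cylinder s).
Proof.
rewrite cylinderE; apply: fin_bigcap_measurable => // i _; exact: X_random.
Qed.

Lemma prob_cylinder (t : nat) (s : t.-tuple T) :
  P (cylinder s) = ((all [in D] s)%:R / #|D|%:R ^+ t)%:E.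
Proof.
rewrite cylinderE X_independent.
rewrite (perm_big _ (seq_fset_perm _ _)) undup_id ?iota_uniq//=.
have -> : iota 0 t = index_iota 0 t by rewrite /index_iota subn0.
rewrite big_mkord.
have -> : (\prod_(i < t) P (X i @^-1` nth_set s i) =
    \prod_(i < t) ((tnth s i \in D)%:R / #|D|%:R)%:E)%E.
  apply: eq_bigr => i _; rewrite -(X_uniform i); congr (P (_ @^-1` _)).
  apply/seteqP; split => x /=; first by rewrite /nth_set /= (tnth_nth x) => ->.
  by move=> ->; rewrite /nth_set /= -tnth_nth.
rewrite prodEFin; congr _%:E.
rewrite big_split /= prodr_const card_ord exprVn; congr (_ * _).
rewrite -(big_tuple _ _ s xpredT (fun x => (x \in D)%:R)).
by elim: (tval s) => [|x u IH]; rewrite ?big_nil// big_cons IH -natrM mulnb.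
Qed.

(** As [T] is finite, the union is finite: measurability and probability reduce to single
    cylinders. *)
Lemma draws_bigcup (t : nat) (Q : pred (seq T)) :
  [set w | Q (draws t w)] =
  \bigcup_(s in [set` [pred s : t.-tuple T | Q s]]) cylinder s.
Proof.
apply/seteqP; split => w /=; last by case=> s Qs; rewrite /cylinder /= => ->.
move=> Qw; have sz : size (draws t w) == t by rewrite size_map size_iota.
by exists (Tuple sz).
Qed.

Lemma measurable_draws (t : nat) (Q : pred (seq T)) :
  measurable [set w | Q (draws t w)].
Proof.
rewrite draws_bigcup; apply: fin_bigcup_measurable => [|s _].
  exact: finite_finset.
exact: measurable_cylinder.
Qed.

Lemma prob_draws (t : nat) (Q : pred (seq T)) :
  P [set w | Q (draws t w)] =
  ((\sum_(s : t.-tuple T) (all [in D] s && Q s))%:R / #|D|%:R ^+ t)%:E.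
Proof.
rewrite draws_bigcup measure_fin_bigcup; last 3 first.
- exact: finite_finset.
- by move=> s u _ _ [w [/= ws wu]]; apply: val_inj; rewrite /= -ws -wu.
- by move=> s _; exact: measurable_cylinder.
rewrite -(bigfs _ (r := index_enum _)) ?index_enum_uniq//; last first.
  by move=> s _; rewrite mem_index_enum.
rewrite (eq_bigr _ (fun s _ => prob_cylinder s)).
rewrite sumEFin; congr _%:E.
rewrite -mulr_suml natr_sum; congr (_ * _).
by rewrite big_mkcond; apply: eq_bigr => s _; rewrite andbC /=; case: (Q s).
Qed.

End FiniteDraws.

(** * The expectation of T(1) *)

Lemma sum_matching_draws (V : finType) (t : nat) :
  (\sum_(s : t.-tuple {set V}) (pairs s && matching s) =
   \sum_(0 <= k < (#|V| %/ 2).+1) matching_draws V t k)%N.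
Proof.
rewrite big_mkord exchange_big /=; apply: eq_bigr => s _.
have [/andP[ps ms]|] := boolP (pairs s && matching s); last first.
  move=> /nandP pms; rewrite big1// => k _.
  by case: pms => /negPf ->; rewrite ?andbF.
(* A matching has at most |V| / 2 edges, so its size is the one index in range that contributes. *)
have sV : (size (undup s) < (#|V| %/ 2).+1)%N.
  by have := leq_size_matching ps ms; lia.
rewrite (bigD1 (Ordinal sV))//= ps ms eqxx big1// => k.
by rewrite -val_eqE /= eq_sym => /negPf ->.
Qed.

Section ExpectedT1.
Variables (R : realType) (n : nat) (X : coupon_problem R n).
Hypothesis n3 : (3 <= n)%N.

(** Samples are pairs only almost surely, so the event is defined by determination itself and
    compared with matchings only on lists of pairs. *)
Let undetermined (s : seq {set coupon X}) : bool :=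
  `[< ~ exists c,
        label_determined [seq observe (labeling (c := X)) e | e <- s] c >].

Let undetermined_at (t : nat) : set (Defs.space X) :=
  [set w | undetermined [seq sample i w | i <- iota 0 t]].

Lemma undetermined_pairs (s : seq {set coupon X}) :
  pairs s -> undetermined s = matching s.
Proof.
move=> ps; have det := exists_label_determined (labeling_bij X) ps.
apply/asboolP/idP => [undet|ms /det]; last by rewrite ms.
by apply: contra_notT undet => /det.
Qed.

Lemma T1_series (w : Defs.space X) :
  T1 w = (\sum_(0 <= t <oo) (\1_(undetermined_at t) w)%:E)%E.
Proof.
rewrite /T1 ereal_inf_upward_closed => [|t u tu [c det]].
  apply: eq_eseriesr => t _; rewrite !indicE; congr (_%:R%:E).
  congr nat_of_bool; apply/idP/idP; rewrite !inE /= /undetermined_at /=.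
    by move=> det; apply/asboolP; rewrite -map_comp.
  by move=> /asboolP; rewrite -map_comp.
(* Further samples keep a determined label determined, so the set of times is upward closed. *)
exists c; move: det.
rewrite /observations map_comp [X in _ -> label_determined X _]map_comp.
apply: label_determined_sub => e /mapP[i]; rewrite mem_iota => it ->.
by apply: map_f; rewrite mem_iota; lia.
Qed.

Lemma prob_undetermined (t : nat) :
  prob X (undetermined_at t) =
  (\sum_(0 <= k < (n %/ 2).+1) matching_prob R (coupon X) t k)%:E.
Proof.
rewrite (prob_draws (@sample_random _ _ X) (@sample_uniform _ _ X)
  (@sample_independent _ _ X)); congr _%:E.
rewrite card_draws (card_coupon X).
transitivity ((\sum_(s : t.-tuple {set coupon X}) (pairs s && matching s))%:R
    / 'C(n, 2)%:R ^+ t : R).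
  congr (_%:R / _); apply: eq_bigr => s _; congr nat_of_bool.
  rewrite (_ : all _ s = pairs s); last by apply: eq_all => e; rewrite inE.
  (* Lists containing a set that is not a pair contribute 0 on both sides. *)
  by case: (boolP (pairs s)) => //= ps; rewrite undetermined_pairs.
rewrite sum_matching_draws card_coupon natr_sum mulr_suml.
by apply: eq_bigr => k _; rewrite /matching_prob card_coupon.
Qed.

(** All terms are nonnegative, so the integral and then the finite sum over sizes can be exchanged
    with the series over time. *)
Lemma expected_T1E :
  expected_T1 X = (\sum_(0 <= k < (n %/ 2).+1) matching_time R n k)%:E.
Proof.
have V3 : (3 <= #|coupon X|)%N by rewrite card_coupon.
have mU t : measurable (undetermined_at t).
  by apply: measurable_draws => i; exact: sample_random.
rewrite /expected_T1; under eq_integral do rewrite T1_series.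
rewrite integral_nneseries//; last first.
  by move=> t; apply/measurable_realfun.measurable_EFinP;
    exact: measurable_realfun.measurable_indic.
have int_undetermined t : (\int[prob X]_w (\1_(undetermined_at t) w)%:E =
    \sum_(0 <= k < (n %/ 2).+1) (matching_prob R (coupon X) t k)%:E)%E.
  rewrite integral_indic// setIT sumEFin; exact: prob_undetermined.
rewrite (eq_eseriesr (fun t _ => int_undetermined t)).
rewrite nneseries_sum_nat => [|k t]; last first.
  by rewrite lee_fin divr_ge0// exprn_ge0.
rewrite -sumEFin; apply: eq_big_nat => k /andP[_ kn].
have cvg_time : series (fun t => matching_prob R (coupon X) t k) @ \oo -->
    matching_time R n k.
  have := @cvg_matching_time R _ V3 k; rewrite card_coupon; apply; lia.
rewrite -(cvg_lim _ cvg_time)// -EFin_lim; last first.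
  by apply/cvg_ex; exists (matching_time R n k).
by congr (limn _); apply/funext => t /=; rewrite sumEFin.
Qed.

End ExpectedT1.

Theorem theorem2 (R : realType) :
  (forall (n : nat) (X : coupon_problem R n), (3 <= n)%N ->
     let m := ((n - 2) * (n + 1) %/ 2)%N in
     expected_T1 X =
       (1 + \sum_(1 <= i < (n %/ 2).+1)
              n`!%:R / ((n - 2 * i)`!%:R * 2 ^+ i) *
              ((m - i)`!%:R / m`!%:R))%:E) /\
  (forall e : nat -> R,
     (forall n : nat, (3 <= n)%N ->
        exists X : coupon_problem R n, expected_T1 X = (e n)%:E) ->
     e =O_\oo (fun n : nat => n%:R : R)).
Proof.
split=> [n X n3 m|e eE].
  (* The summand of size 0 is the leading 1. *)
  rewrite expected_T1E// big_nat_recl// big_add1 /= matching_time0.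
  have -> : m = 'C(n, 2).-1 by rewrite /m bin2; nia.
  by [].
(* There are [n %/ 2 + 1] summands, at most [n] of them, and each is at most 2. *)
apply/eqO_exP; exists 2 => //; near=> n.
have n3 : (3 <= n)%N by near: n; exact: nbhs_infty_ge.
have [X] := eE n n3; rewrite expected_T1E// => -[<-].
rewrite !ger0_norm ?sumr_ge0// => [|k _]; last exact: matching_time_ge0.
apply: (@le_trans _ _ (\sum_(0 <= k < (n %/ 2).+1) 2)).
  by apply: ler_sum_nat => k /andP[_ kn]; apply: matching_time_le2; lia.
rewrite big_const_nat iter_addr_0 subn0 -[leLHS]mulr_natr ler_pM2l// ler_nat.
lia.
Unshelve. all: by end_near.
Qed.
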